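(* Let $(C_n)_{n\ge1}$ be a stabilizing $\mathrm{Sym}$-invariant chain of cones with stability index $r$, and for each $n$ let $C_n^*=\{v\in\mathbb{R}^n\mid \langle u,v\rangle\ge0 \text{ for all } u\in C_n\}$ be the dual cone of $C_n$ taken in $\mathbb{R}^n$. Suppose $F_{2r}\subseteq \mathbb{O}(\mathbb{R}^{2r})$ is a set with $\mathrm{cone}(F_{2r})=\mathbb{O}(C_{2r}^* )$. Then for every $n>2r$, the set $$F_n:=\bigcup_{u\in F_{2r}} F_{r,n}(u)$$ is a $\mathrm{Sym}(n)$-equivariant generating set for $C_n^*$, i.e. $C_n^*=\mathrm{cone}(\mathrm{Sym}(n)(F_n))$.
   Context: $\mathbb{R}^{(\mathbb{N})}$ denotes the space of real sequences $(u_i)_{i\in\mathbb{N}}$ ($\mathbb{N}=\{1,2,\dots\}$) with only finitely many nonzero entries, with standard basis $e_1,e_2,\dots$; $\mathbb{R}^n$ is identified with the span of $e_1,\dots,e_n$. $\mathrm{Sym}(n)$ is the symmetric group on $[n]=\{1,\dots,n\}$, acting on $\mathbb{R}^n$ by $\sigma(u)=\sum_i u_ie_{\sigma(i)}$; $\mathrm{Sym}(n)\subseteq\mathrm{Sym}(n+1)$ as the stabilizer of $n+1$. For a set $A$, $\mathrm{cone}(A)$ is the set of finite nonnegative linear combinations of elements of $A$, and $\mathrm{Sym}(n)(A)=\{\sigma(a)\mid\sigma\in\mathrm{Sym}(n),a\in A\}$. A $\mathrm{Sym}$-invariant chain of cones is a sequence $(C_n)_{n\ge1}$ where each $C_n\subseteq\mathbb{R}^n$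 is a $\mathrm{Sym}(n)$-invariant convex cone and $C_n\subseteq C_{n+1}$. It stabilizes if there is $r$ with $C_n=\mathrm{cone}(\mathrm{Sym}(n)(C_m))$ for all $n\ge m\ge r$; the least such $r$ is the stability index. A $\mathrm{Sym}(n)$-equivariant generating set of a $\mathrm{Sym}(n)$-invariant cone $D$ is a set $A$ with $D=\mathrm{cone}(\mathrm{Sym}(n)(A))$. $\langle u,v\rangle=\sum_iu_iv_i$. Notation: $\mathbb{O}(\mathbb{R}^n)=\{(u_1,\dots,u_n)\in\mathbb{R}^n\mid u_1\le\dots\le u_n\}$ and $\mathbb{O}(D)=\mathbb{O}(\mathbb{R}^n)\cap D$ for $D\subseteq\mathbb{R}^n$. For reals $a\le b$ and $k\ge1$, $I_k(a,b)$ is the set of non-decreasing vectors in $\mathbb{R}^k$ all of whose entries are $a$ or $b$ (i.e. $(a^{(j)},b^{(k-j)})$, $0\le j\le k$). For $u=(u_1,\dots,u_n)\in\mathbb{O}(\mathbb{R}^n)$, $i\in[n-1]$ and $m>n$, $F_{i,m}(u)=\{(u_1,\dots,u_i,w,u_{i+1},\dots,u_n)\mid w\in I_{m-n}(u_i,u_{i+1})\}\subseteq\mathbb{O}(\mathbb{R}^m)$. *)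

(* Defs.v *)
From mathcomp Require Import all_boot all_order all_fingroup all_algebra.
From mathcomp Require Import classical_sets reals.

Set Implicit Arguments.
Unset Strict Implicit.
Unset Printing Implicit Defensive.

Import Order.TTheory GRing.Theory Num.Theory.

Local Open Scope classical_set_scope.
Local Open Scope ring_scope.

(* R^n is 'rV[R]_n. The coordinates u_1, ..., u_n of a vector u are
   u 0 0, ..., u 0 (n - 1), that is, the entries of the list [entries u]. *)

Section Vectors.
Variable R : realType.

Definition entries (n : nat) (u : 'rV[R]_n) : seq R := codom (u 0).

(* The inclusion of R^m in R^n as the span of e_1, ..., e_m, for m <= n
   (if n < m it truncates; this case is never used). *)
Definition embed (m n : nat) (u : 'rV[R]_m) : 'rV[R]_n :=
  \row_(j < n) (entries u)`_j.

Definition sym_act (n : nat) (s : 'S_n) (u : 'rV[R]_n) : 'rV[R]_n :=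
  \sum_(i < n) u 0 i *: delta_mx 0 (s i).

Definition sym_orbit (n : nat) (A : set 'rV[R]_n) : set 'rV[R]_n :=
  [set v | exists (s : 'S_n) (a : 'rV[R]_n), A a /\ v = sym_act s a].

(* The empty combination (k = 0) is allowed, so 0 always belongs to cone A. *)
Definition cone (n : nat) (A : set 'rV[R]_n) : set 'rV[R]_n :=
  [set v | exists (k : nat) (c : 'I_k -> R) (a : 'I_k -> 'rV[R]_n),
     (forall i, 0 <= c i /\ A (a i)) /\ v = \sum_(i < k) c i *: a i].

Definition convex_cone (n : nat) (D : set 'rV[R]_n) : Prop := D = cone D.

Definition sym_invariant (n : nat) (D : set 'rV[R]_n) : Prop :=
  forall (s : 'S_n) (u : 'rV[R]_n), D u -> D (sym_act s u).

Definition equivariant_generating_set (n : nat) (A D : set 'rV[R]_n) : Prop :=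
  D = cone (sym_orbit A).

Definition inner (n : nat) (u v : 'rV[R]_n) : R := \sum_(i < n) u 0 i * v 0 i.

Definition dual_cone (n : nat) (D : set 'rV[R]_n) : set 'rV[R]_n :=
  [set v | forall u, D u -> 0 <= inner u v].

Definition nondecreasing_vec (n : nat) : set 'rV[R]_n :=
  [set u | forall i j : 'I_n, (i <= j)%N -> u 0 i <= u 0 j].

Definition ordered_part (n : nat) (D : set 'rV[R]_n) : set 'rV[R]_n :=
  @nondecreasing_vec n `&` D.

Definition two_valued (k : nat) (a b : R) : set 'rV[R]_k :=
  [set w | nondecreasing_vec w /\ forall j, w 0 j = a \/ w 0 j = b].

(* F_{i,m}(u), for u in R^n, 1 <= i < n and n < m. With u_i and u_{i+1}
   numbered from 1 as usual, they are the entries of index i - 1 and i of the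
   list [entries u]. *)
Definition insertions (n i m : nat) (u : 'rV[R]_n) : set 'rV[R]_m :=
  [set v | exists2 w : 'rV[R]_(m - n),
     two_valued (entries u)`_i.-1 (entries u)`_i w &
     entries v = take i (entries u) ++ entries w ++ drop i (entries u)].

(* Chains are indexed by n >= 1; the component C 0 is irrelevant. *)
Definition sym_invariant_chain (C : forall n : nat, set 'rV[R]_n) : Prop :=
  forall n : nat, (1 <= n)%N ->
    [/\ convex_cone (C n), sym_invariant (C n) &
        forall u, C n u -> C n.+1 (embed n.+1 u)].

Definition stabilizes_from (C : forall n : nat, set 'rV[R]_n) (r : nat) : Prop :=
  (1 <= r)%N /\
  forall m n : nat, (r <= m)%N -> (m <= n)%N ->
    C n = cone (sym_orbit (@embed m n @` C m)).

(* In particular, the chain stabilizes. *)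
Definition stability_index (C : forall n : nat, set 'rV[R]_n) (r : nat) : Prop :=
  stabilizes_from C r /\ forall s : nat, stabilizes_from C s -> (r <= s)%N.

End Vectors.

Arguments embed {R m} n u.
Arguments nondecreasing_vec {R} n.
Arguments insertions {R n} i m u.

(* Main.v *)
(** A vector [v] lies in [C_n^*] iff [sum_i u_i v_(f i) >= 0] for all [u] in
    [C_r] and all injections [f : [r] -> [n]]. If [v] is non-decreasing, moving
    the nonnegative entries of [u] to the left and the negative ones to the
    right decreases the sum, so only the first [r] and the last [r] entries of
    [v] matter: [v] is in [C_n^*] iff the vector [v'] of these [2r] entries is in
    [C_(2r)^*]. The entries in between lie in [[v'_r, v'_(r+1)]], so [v] is a
    convex combination of the vectors obtained from [v'] by inserting a
    two-valued step; for a fixed step, insertion is linear in [v'], so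
    decomposing [v'] over [F_(2r)] decomposes [v] over [F_n]. *)

Require Import Defs.
From mathcomp Require Import all_boot all_order all_fingroup all_algebra.
From mathcomp Require Import classical_sets reals.
From mathcomp Require Import zify.

Import Order.TTheory GRing.Theory Num.Theory.

Local Open Scope classical_set_scope.
Local Open Scope ring_scope.

(** * Coordinates, the permutation action and cones *)

Lemma size_entries {R : realType} {n : nat} (u : 'rV[R]_n) :
  size (entries u) = n.
Proof. by rewrite size_codom card_ord. Qed.

Lemma nth_entries {R : realType} {n : nat} (u : 'rV[R]_n) (j : 'I_n) :
  (entries u)`_j = u 0 j.
Proof. by rewrite (nth_map j) ?size_enum_ord // nth_ord_enum. Qed.

Lemma nth_entriesE {R : realType} {n : nat} (u : 'rV[R]_n) k (h : (k < n)%N) :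
  (entries u)`_k = u 0 (Ordinal h).
Proof. exact: nth_entries u (Ordinal h). Qed.

Lemma nondecreasing_entries {R : realType} {n : nat} (u : 'rV[R]_n) i j :
  nondecreasing_vec n u -> (i <= j)%N -> (j < n)%N ->
  (entries u)`_i <= (entries u)`_j.
Proof.
move=> hu ij hj.
by rewrite (nth_entriesE u i (leq_ltn_trans ij hj)) (nth_entriesE u j hj) hu.
Qed.

Lemma sym_actE {R : realType} {n : nat} (s : 'S_n) (u : 'rV[R]_n) j :
  sym_act s u 0 (s j) = u 0 j.
Proof.
rewrite /sym_act summxE (bigD1 j) //= big1 ?addr0; last first.
  by move=> i ij; rewrite !mxE (inj_eq perm_inj) eq_sym (negbTE ij) andbF mulr0.
by rewrite !mxE !eqxx mulr1.
Qed.

Lemma sym_act_sum {R : realType} {n : nat} (s : 'S_n) (I : finType)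
    (c : I -> R) (a : I -> 'rV[R]_n) :
  sym_act s (\sum_i c i *: a i) = \sum_i c i *: sym_act s (a i).
Proof.
apply/rowP => j; rewrite -[j](permKV s) sym_actE !summxE.
by apply: eq_bigr => i _; rewrite !mxE sym_actE.
Qed.

(** Enumerating [I] turns the sum into one over an ordinal, as [cone] demands. The final
    decomposition needs this for pairs of indices. *)
Lemma mem_cone_sum {R : realType} {n : nat} (A : set 'rV[R]_n) (I : finType)
    (c : I -> R) (a : I -> 'rV[R]_n) :
  (forall i, 0 <= c i /\ A (a i)) -> cone A (\sum_i c i *: a i).
Proof.
move=> h; exists #|I|, (fun k => c (enum_val k)), (fun k => a (enum_val k)).
split=> [i|]; first exact: h.
by rewrite (reindex (fun k : 'I_#|I| => enum_val k)) //; apply/onW_bij/enum_val_bij.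
Qed.

Lemma mem_cone {R : realType} {n : nat} (A : set 'rV[R]_n) a : A a -> cone A a.
Proof.
move=> Aa; have := @mem_cone_sum R n A 'I_1 (fun=> 1) (fun=> a).
by rewrite big_ord1 scale1r; apply=> _; split.
Qed.

(** * Injections, permutations and the dual cones of the chain *)

(** The values of [f] followed by the remaining elements list ['I_n] without repetition, so reading
    off this list is a permutation. *)
Lemma injection_extends_perm {m n : nat} (hmn : (m <= n)%N) (f : 'I_m -> 'I_n) :
  injective f -> exists s : 'S_n, forall i, s (widen_ord hmn i) = f i.
Proof.
move=> finj.
pose t := codom f ++ [seq j <- enum 'I_n | j \notin codom f].
have ut : uniq t.
  rewrite cat_uniq; apply/and3P; split.
  - exact/injectiveP.
  - by apply/hasPn => j; rewrite mem_filter => /andP[].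
  - by rewrite filter_uniq // enum_uniq.
have st : size t = n.
  rewrite -[RHS](card_ord n) cardE; apply/perm_size/uniq_perm => //.
    exact: enum_uniq.
  by move=> j; rewrite mem_cat mem_filter mem_enum andbT; case: (_ \in _).
have gi : injective (fun i : 'I_n => nth i t i).
  move=> i j; rewrite (set_nth_default i j) ?st // => /eqP.
  by rewrite nth_uniq ?st // => /eqP/val_inj.
exists (perm gi) => i.
rewrite permE /= nth_cat size_codom card_ord ltn_ord.
by rewrite (nth_map i) ?size_enum_ord // nth_ord_enum.
Qed.

(* [p i] is the rank of [f i] in the image of [f]. *)
Lemma injection_rank {r n : nat} (f : 'I_r -> 'I_n) :
  injective f -> exists2 p : 'I_r -> 'I_r, injective p &
    forall i, (p i <= f i)%N /\ (f i + r <= n + p i)%N.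
Proof.
move=> finj; pose S i := [set j | (f j < f i)%N]%SET.
have Slt i : (#|S i| < r)%N.
  rewrite -[X in (_ < X)%N](card_ord r) -cardsT; apply/proper_card/properP.
  by split; [exact: finset.subsetT | exists i; rewrite !inE ?ltnn].
exists (fun i => Ordinal (Slt i)).
  have Sprop i j : (f i < f j)%N -> (#|S i| < #|S j|)%N.
    move=> ij; apply/proper_card/properP; split.
      by apply/fintype.subsetP => k; rewrite !inE => /ltn_trans; apply.
    by exists i; rewrite !inE ?ltnn.
  move=> i j [] e; apply/finj/val_inj => /=.
  by case: (ltngtP (f i) (f j)) => // /Sprop; rewrite e ltnn.
have cT k : (k <= n)%N -> #|[set j : 'I_n | (j < k)%N]%SET| = k.
  move=> kn; have winj : injective (widen_ord kn).
    by move=> x y e; apply/val_inj; exact: (congr1 val e).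
  rewrite -[RHS](card_ord k) -[RHS](card_imset _ winj).
  apply: eq_card => j; rewrite inE; apply/idP/imsetP.
    by move=> jk; exists (Ordinal jk) => //; apply/val_inj.
  by case=> x _ ->; rewrite /= ltn_ord.
(* First bound: [f] injects [S i] into the positions below [f i]. Second bound: it injects the
   complement of [S i] into the [n - f i] remaining positions. *)
move=> i; rewrite -[nat_of_ord (Ordinal _)]/(#|S i|); split.
  rewrite -[X in (_ <= X)%N](cT (f i)) ?(ltnW (ltn_ord _)) //.
  rewrite -(card_imset _ finj); apply/subset_leq_card/fintype.subsetP => k /imsetP[j].
  by rewrite !inE => ? ->.
have h : (#|~: S i| <= #|~: [set j : 'I_n | (j < f i)%N]%SET|)%N.
  rewrite -(card_imset _ finj); apply/subset_leq_card/fintype.subsetP => k /imsetP[j].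
  by rewrite !inE => ? ->.
have := cardsC (S i); have := cardsC [set j : 'I_n | (j < f i)%N]%SET.
rewrite cT ?(ltnW (ltn_ord _)) // !card_ord; have := ltn_ord (f i); lia.
Qed.

(** [C n] is generated by the orbit of [C r], and pairing [v] with a permuted [u] in [C r] only
    involves the images of the first [r] positions. By [injection_extends_perm] these images form an
    arbitrary injection. *)
Lemma dual_cone_stableP {R : realType} {C : forall n : nat, set 'rV[R]_n}
    {r n : nat} (v : 'rV[R]_n) :
  stabilizes_from C r -> (r <= n)%N ->
  dual_cone (C n) v <->
  (forall (u : 'rV[R]_r) (f : 'I_r -> 'I_n), C r u -> injective f ->
    0 <= \sum_i u 0 i * v 0 (f i)).
Proof.
move=> [_ hst] hrn; rewrite (hst r n (leqnn r) hrn).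
have inner_act s (u : 'rV[R]_r) :
    inner (sym_act s (embed n u)) v =
    \sum_i u 0 i * v 0 (s (widen_ord hrn i)).
  rewrite /inner (reindex_perm s) /=.
  (* Extending the summand to all naturals lets the range shrink from [n] to [r]: past [r] the
     entries of [u] default to 0. *)
  pose G k := (entries u)`_k * (if insub k is Some j then v 0 (s j) else 0).
  transitivity (\sum_(i < n) G i).
    by apply: eq_bigr => i _; rewrite sym_actE mxE /G valK.
  transitivity (\sum_(i < r) G i); last first.
    apply: eq_bigr => i _; rewrite /G nth_entries.
    by rewrite -[nat_of_ord i]/(val (widen_ord hrn i)) valK.
  rewrite (big_ord_widen n G hrn) [RHS]big_mkcond; apply: eq_bigr => i _.
  by case: ltnP => // h; rewrite /G nth_default ?size_entries // mul0r.
split=> [h u f Cu /(injection_extends_perm hrn)[s hs]|h _ [k [c [a [ca ->]]]]].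
  under eq_bigr do rewrite -hs; rewrite -inner_act; apply: h.
  by apply: mem_cone; exists s, (embed n u); split=> //; exists u.
have -> : inner (\sum_i c i *: a i) v = \sum_i c i * inner (a i) v.
  rewrite /inner; under [RHS]eq_bigr do rewrite mulr_sumr.
  rewrite exchange_big; apply: eq_bigr => j _ /=.
  by rewrite summxE mulr_suml; apply: eq_bigr => i _; rewrite mxE mulrA.
apply: sumr_ge0 => i _; have [c0 [s [_ [[u Cu <-] ->]]]] := ca i.
rewrite mulr_ge0 // inner_act h // => x y /perm_inj e.
by apply/val_inj; exact: (congr1 val e).
Qed.

(** * Extracting the end entries and filling the middle *)

Definition ends {R : realType} (r : nat) {n : nat} (v : 'rV[R]_n) :
    'rV[R]_(2 * r) :=
  \row_(j < 2 * r) (entries v)`_(if (j < r)%N then j : nat else j + (n - 2 * r))%N.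

(** Injections into the [2 * r] end positions are among those into all [n] positions. Conversely, by
    [injection_rank], [v] at [f i] lies between its entries at [p i] and at [n - r + p i], both of
    which [ends] keeps. *)
Lemma dual_cone_ends {R : realType} {C : forall n : nat, set 'rV[R]_n}
    {r n : nat} (v : 'rV[R]_n) :
  stabilizes_from C r -> (2 * r <= n)%N -> nondecreasing_vec n v ->
  dual_cone (C n) v <-> dual_cone (C (2 * r)%N) (ends r v).
Proof.
move=> hst hn hv.
have hrn : (r <= n)%N by lia.
have hr2 : (r <= 2 * r)%N by lia.
rewrite (dual_cone_stableP _ hst hrn) (dual_cone_stableP _ hst hr2); split.
  move=> h u f Cu finj.
  have gP j : ((if (f j < r)%N then f j : nat else f j + (n - 2 * r)) < n)%N.
    by have := ltn_ord (f j); do ?[case: ifP => ?]; lia.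
  have := h u (fun j => Ordinal (gP j)) Cu.
  under eq_bigr do rewrite -nth_entriesE; under [X in _ -> 0 <= X]eq_bigr do rewrite mxE.
  apply=> i j [] e; apply/finj/val_inj; move: e => /=.
  by do ?[case: ifP => ?]; lia.
move=> h u f Cu finj; have [p pinj pP] := injection_rank f finj.
(* Nonnegative entries of [u] go to the first [r] positions in the order of
   [f], negative ones to the last [r]: every term of the sum can only drop. *)
have gP j : ((if (0 <= u 0 j)%R then p j : nat else r + p j) < 2 * r)%N.
  by have := ltn_ord (p j); do ?[case: ifP => ?]; lia.
have := h u (fun j => Ordinal (gP j)) Cu; move/(_ _)/le_trans; apply.
  move=> i j [] e; apply/pinj/val_inj; move: e => /=.
  by have := ltn_ord (p i); have := ltn_ord (p j); do ?[case: ifP => ?]; lia.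
apply: ler_sum => i _; rewrite mxE /=.
have [p1 p2] := pP i; have hp := ltn_ord (p i); have hf := ltn_ord (f i).
rewrite -(nth_entries v (f i)); case: (leP 0 (u 0 i)) => u0.
  by rewrite hp; apply: ler_wpM2l => //; apply: nondecreasing_entries.
rewrite ltnNge leq_addr /=; apply: ler_wnM2l; first exact: ltW.
by apply: nondecreasing_entries => //; lia.
Qed.

(* With [u_1, ..., u_(2r)] numbered from 1, this inserts [s] copies of [u_r]
   followed by [n - 2r - s] copies of [u_(r+1)] between these two entries. *)
Definition spread {R : realType} (r n s : nat) (u : 'rV[R]_(2 * r)) : 'rV[R]_n :=
  \row_(j < n) (entries u)`_(if (j < r + s)%N then minn j r.-1
                            else maxn (j - (n - 2 * r)) r).

Lemma nth_insertion {R : realType} {r n : nat} (u : 'rV[R]_(2 * r))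
    (w : 'rV[R]_(n - 2 * r)) (j : nat) : (2 * r <= n)%N ->
  (take r (entries u) ++ entries w ++ drop r (entries u))`_j =
  if (j < r)%N then (entries u)`_j
  else if (j < n - r)%N then (entries w)`_(j - r)
  else (entries u)`_(j - (n - 2 * r)).
Proof.
move=> hn; rewrite nth_cat size_take_min size_entries.
have -> : minn r (2 * r) = r by lia.
case: ltnP => jr; first by rewrite nth_take.
rewrite nth_cat size_entries.
have -> : (j - r < n - 2 * r)%N = (j < n - r)%N by lia.
by case: ltnP => jn //; rewrite nth_drop; congr (_`_ _); lia.
Qed.

Lemma spread_insertions {R : realType} {r n : nat} (s : nat) (u : 'rV[R]_(2 * r)) :
  (1 <= r)%N -> (2 * r <= n)%N -> (s <= n - 2 * r)%N ->
  nondecreasing_vec (2 * r) u -> insertions r n u (spread r n s u).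
Proof.
move=> hr hn hs hu.
pose w : 'rV[R]_(n - 2 * r) :=
  \row_(j < n - 2 * r) (entries u)`_(if (j < s)%N then r.-1 else r).
exists w.
  split=> [i j ij|j]; rewrite !mxE; last by case: ifP; [left | right].
  by apply: nondecreasing_entries => //; do ?[case: ifP => ?]; lia.
apply: (@eq_from_nth _ 0) => [|j].
  by rewrite !size_cat size_take_min size_drop !size_entries; lia.
rewrite size_entries => hj; rewrite nth_insertion // (nth_entriesE _ _ hj) mxE /=.
case: (ltnP j r) => jr.
  by rewrite ifT; [congr (_`_ _); lia | lia].
case: (ltnP j (n - r)) => jn; last first.
  by rewrite ifF; [congr (_`_ _); lia | lia].
have hjr : (j - r < n - 2 * r)%N by lia.
rewrite (nth_entriesE w _ hjr) mxE /=; congr (_`_ _).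
by do ?[case: ifP => ?]; lia.
Qed.

(** Inserted values lie between the two entries around the block. This makes [dual_cone_ends]
    applicable to the generators. *)
Lemma insertions_nondecreasing {R : realType} {r n : nat} (u : 'rV[R]_(2 * r))
    (v : 'rV[R]_n) :
  (1 <= r)%N -> (2 * r <= n)%N -> nondecreasing_vec (2 * r) u ->
  insertions r n u v -> nondecreasing_vec n v.
Proof.
move=> hr hn hu [w [hw w2] e] i j ij; rewrite -!nth_entries e !nth_insertion //.
have hj := ltn_ord j.
have hab : (entries u)`_r.-1 <= (entries u)`_r.
  by apply: nondecreasing_entries => //; lia.
have wP k : (k < n - 2 * r)%N ->
    (entries u)`_r.-1 <= (entries w)`_k <= (entries u)`_r.
  by move=> hk; rewrite (nth_entriesE _ _ hk); case: (w2 (Ordinal hk)) => ->; rewrite lexx hab.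
case: (ltnP i r) => ir; case: (ltnP j r) => jr; try lia.
- by apply: nondecreasing_entries => //; lia.
- case: ltnP => jn; last by apply: nondecreasing_entries => //; lia.
  have /wP/andP[+ _] : (j - r < n - 2 * r)%N by lia.
  by apply: le_trans; apply: nondecreasing_entries => //; lia.
- case: ltnP => iN; case: ltnP => jn; try lia.
  + by apply: nondecreasing_entries => //; lia.
  + have /wP/andP[_ /le_trans] : (i - r < n - 2 * r)%N by lia.
    by apply; apply: nondecreasing_entries => //; lia.
  + by apply: nondecreasing_entries => //; lia.
Qed.

(** The inserted block occupies exactly the middle positions that [ends] forgets. *)
Lemma ends_insertions {R : realType} {r n : nat} (u : 'rV[R]_(2 * r))
    (v : 'rV[R]_n) :
  (2 * r <= n)%N -> insertions r n u v -> ends r v = u.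
Proof.
move=> hn [w _ e]; apply/rowP => j; rewrite mxE e nth_insertion //.
have hj := ltn_ord j; case: (ltnP j r) => jr; rewrite ?jr ?nth_entries //.
rewrite ifF; last lia; rewrite ifF; last lia.
by rewrite addnK nth_entries.
Qed.

(** For fixed [s], each coordinate of [spread] is a fixed coordinate of its argument, hence
    linear. *)
Lemma spread_sum {R : realType} {r n : nat} (s : nat) (I : finType)
    (c : I -> R) (a : I -> 'rV[R]_(2 * r)) :
  (1 <= r)%N -> (2 * r <= n)%N ->
  spread r n s (\sum_i c i *: a i) = \sum_i c i *: spread r n s (a i).
Proof.
move=> hr hn; apply/rowP => j; rewrite summxE mxE.
have h : ((if (j < r + s)%N then minn j r.-1 else maxn (j - (n - 2 * r)) r)
          < 2 * r)%N.
  by have := ltn_ord j; do ?[case: ifP => ?]; lia.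
rewrite (nth_entriesE _ _ h) summxE; apply: eq_bigr => i _.
by rewrite !mxE (nth_entriesE _ _ h).
Qed.

(* The middle entries of [v], rescaled to [0, 1] by [v_r |-> 0] and
   [v_(n-r+1) |-> 1], are a convex combination of 0/1 step vectors whose
   weights are the successive increments. *)
Lemma spread_ends_decomposition {R : realType} {r n : nat} (v : 'rV[R]_n) :
  (1 <= r)%N -> (2 * r <= n)%N -> nondecreasing_vec n v ->
  exists2 l : 'I_(n - 2 * r).+1 -> R, (forall s, 0 <= l s) &
    v = \sum_s l s *: spread r n s (ends r v).
Proof.
move=> hr hn hv; have [m hm] : exists m, m = (n - 2 * r)%N by exists (n - 2 * r)%N.
rewrite -hm.
pose e k := (entries v)`_k; pose a := e r.-1; pose b := e (r + m)%N.
have hab : a <= b by apply: nondecreasing_entries => //; lia.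
have endsE k : (k < 2 * r)%N ->
    (entries (ends r v))`_k = e (if (k < r)%N then k else (k + m)%N).
  by move=> hk; rewrite (nth_entriesE _ _ hk) mxE hm.
have spE s (j : 'I_n) : (s <= m)%N -> spread r n s (ends r v) 0 j =
    if (j < r)%N || (r + m <= j)%N then e j else if (j < r + s)%N then a else b.
  have hj := ltn_ord j.
  move=> hs; rewrite mxE endsE; last by do ?[case: ifP => ?]; lia.
  by rewrite /a /b; case: (ltnP j (r + s)) => ?; do ?[case: ifP => ?]; try (congr (e _)); lia.
(* Rescaling would divide by 0 here, but the middle of [v] is constant, so the single step [s = 0]
   suffices. *)
have [eab|neab] := eqVneq a b.
  exists (fun s => (s == ord0)%:R) => [s|]; first by case: eqP.
  rewrite (bigD1 ord0) //= scale1r big1 ?addr0; last first.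
    by move=> s /negbTE ->; rewrite scale0r.
  apply/rowP => j; rewrite spE //; have hj := ltn_ord j.
  case: ifP => h; first by rewrite /e nth_entries.
  rewrite -eab if_same; apply/eqP.
  rewrite -nth_entries eq_le {1}eab; apply/andP; split;
    apply: nondecreasing_entries => //; lia.
have ba : 0 < b - a by rewrite subr_gt0 lt_neqAle neab.
(* The [m] middle entries together with [a] and [b] give [m + 1] increments, one for each [s] from 0
   to [m]. *)
exists (fun s => (e (r.-1 + s).+1 - e (r.-1 + s)%N) / (b - a)).
  move=> s; have := ltn_ord s => hs; apply: divr_ge0; last exact: ltW.
  by rewrite subr_ge0; apply: nondecreasing_entries => //; lia.
have tele k : \sum_(0 <= s < k) (e (r.-1 + s).+1 - e (r.-1 + s)%N) / (b - a) =
    (e (r.-1 + k)%N - a) / (b - a).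
  rewrite -mulr_suml; congr (_ / _).
  rewrite (telescope_sumr_eq (fun s => e (r.-1 + s)%N)) ?addn0 //.
  by move=> s _; rewrite addnS.
(* Total weight 1 reproduces the end coordinates, which no step changes. *)
have tele1 : \sum_(0 <= s < m.+1) (e (r.-1 + s).+1 - e (r.-1 + s)%N) / (b - a) = 1.
  rewrite tele -[X in e X]/(r.-1 + m.+1)%N.
  have -> : (r.-1 + m.+1 = r + m)%N by lia.
  by rewrite divff // gt_eqF.
apply/rowP => j; rewrite summxE; have hj := ltn_ord j.
under eq_bigr => s _.
  rewrite mxE spE; last by rewrite -ltnS ltn_ord.
  over.
case: (boolP ((j < r)%N || (r + m <= j)%N)) => h.
  rewrite -mulr_suml -(big_mkord xpredT (fun s => (e (r.-1 + s).+1 - e (r.-1 + s)%N) / (b - a))).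
  by rewrite tele1 mul1r /e nth_entries.
rewrite -(big_mkord xpredT (fun s => (e (r.-1 + s).+1 - e (r.-1 + s)%N) / (b - a) *
  (if (j < r + s)%N then a else b))) /=.
(* At a middle position [j], step [s] takes the value [b] exactly when [s <= j - r]. These weights
   telescope to [(e j - a) / (b - a)]. *)
transitivity (a + (b - a) * \sum_(0 <= s < (j - r).+1)
    (e (r.-1 + s).+1 - e (r.-1 + s)%N) / (b - a)).
  rewrite tele mulrCA divff ?gt_eqF // mulr1 addrC subrK.
  by rewrite -nth_entries; congr (e _); lia.
(* Spreading [a] over all weights allows a termwise comparison on both sides of the cut at
   [j - r + 1]. *)
rewrite -[X in X + _]mulr1 -tele1.
rewrite (big_cat_nat (n := (j - r).+1)) //=; last lia.
rewrite [RHS](big_cat_nat (n := (j - r).+1)) //=; last lia.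
rewrite mulrDr addrAC -mulrDl [a + _]addrC subrK !mulr_sumr.
congr (_ + _); apply: eq_big_nat => s hs.
  by rewrite ifF; [rewrite mulrC | lia].
by rewrite ifT; [rewrite mulrC | lia].
Qed.

(** * Sorting and the two inclusions *)

Lemma sorting_perm {R : realType} {n : nat} (v : 'rV[R]_n) :
  exists s : 'S_n, nondecreasing_vec n (\row_j v 0 (s j)).
Proof.
pose t := [tuple v 0 i | i < n].
have /tuple_permP[s hs] : perm_eq (sort_tuple <=%R t) t by rewrite /= perm_sort.
exists s => i j ij; rewrite !mxE.
have E k : v 0 (s k) = nth 0 (sort <=%R t) k.
  rewrite -[sort _ _]/(tval (sort_tuple <=%R t)) hs (nth_map k) ?size_enum_ord //.
  by rewrite nth_ord_enum tnth_mktuple.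
rewrite !E; apply: (sorted_leq_nth (@le_trans _ R) (@lexx _ R)) => //.
- exact/sort_sorted/le_total.
- by rewrite inE size_sort size_tuple.
- by rewrite inE size_sort size_tuple.
Qed.

Theorem theorem3p3 (R : realType) (C : forall n : nat, set 'rV[R]_n) (r : nat)
    (hC : sym_invariant_chain C) (hr : stability_index C r)
    (F : set 'rV[R]_(2 * r)%N)
    (hF : F `<=` nondecreasing_vec (2 * r)%N)
    (hgen : cone F = ordered_part (dual_cone (C (2 * r)%N)))
    (n : nat) (hn : (2 * r < n)%N) :
  equivariant_generating_set (\bigcup_(u in F) insertions r n u)
    (dual_cone (C n)).
Proof.
have [hst _] := hr; have r1 := hst.1; have hn' := ltnW hn.
have hrn : (r <= n)%N by lia.
apply/seteqP; split=> [v hv|_ [k [c [a [ca ->]]]]]; last first.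
  (* By linearity one permuted generator [x] is enough. Its permutation is absorbed into the
     injection, and its ends form the vector [y] of [F]. *)
  apply/(dual_cone_stableP _ hst hrn) => u f Cu finj.
  under eq_bigr do rewrite summxE mulr_sumr.
  rewrite exchange_big; apply: sumr_ge0 => i _ /=.
  have [c0 [s [x [[y Fy hx] ->]]]] := ca i.
  under eq_bigr => j _ do
    rewrite mxE mulrCA -[f j](permKV s) sym_actE.
  rewrite -mulr_sumr mulr_ge0 //.
  have [yo ydual] : ordered_part (dual_cone (C (2 * r)%N)) y.
    by rewrite -hgen; apply: mem_cone.
  have xo := insertions_nondecreasing _ _ r1 hn' yo hx.
  move: ydual; rewrite -(ends_insertions _ _ hn' hx).
  move/(dual_cone_ends _ hst hn' xo)/(dual_cone_stableP _ hst hrn); apply=> //.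
  by move=> p q /perm_inj/finj.
(* Sorting preserves membership in the dual, since composing an injection with [s] gives an
   injection. *)
have [s so] := sorting_perm v; set v0 := \row_j _ in so.
have vE : v = sym_act s v0.
  by apply/rowP => j; rewrite -[j](permKV s) sym_actE mxE.
have v0dual : dual_cone (C n) v0.
  apply/(dual_cone_stableP _ hst hrn) => u f Cu finj.
  move/(dual_cone_stableP _ hst hrn): hv => /(_ u (s \o f) Cu).
  under [X in _ -> 0 <= X]eq_bigr do rewrite mxE.
  by apply; apply: inj_comp => //; apply: perm_inj.
have endso : nondecreasing_vec (2 * r) (ends r v0).
  move=> i j ij; rewrite !mxE; have := ltn_ord j.
  by move=> hj; apply: nondecreasing_entries => //; do ?[case: ifP => ?]; lia.
have : cone F (ends r v0).
  by rewrite hgen; split=> //; apply/(dual_cone_ends _ hst hn' so).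
case=> k [c [a [ca e]]].
have [l l0 v0E] := spread_ends_decomposition v0 r1 hn' so.
(* Expanding over the steps and then over [F] leaves products of nonnegative weights, indexed by
   pairs. *)
have {}v0E : v0 = \sum_(p : 'I_(n - 2 * r).+1 * 'I_k)
    (l p.1 * c p.2) *: spread r n p.1 (a p.2).
  rewrite -(pair_bigA _ (fun i j => (l i * c j) *: spread r n i (a j))) /=.
  rewrite {1}v0E; apply: eq_bigr => i _.
  by rewrite e spread_sum // scaler_sumr; apply: eq_bigr => j _; rewrite scalerA.
rewrite vE v0E sym_act_sum; apply: mem_cone_sum => -[i j] /=.
have [c0 Fa] := ca j; split; first by rewrite mulr_ge0.
exists s, (spread r n i (a j)); split=> //; exists (a j) => //.
apply: spread_insertions => //; first by rewrite -ltnS ltn_ord.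
exact: hF.
Qed.
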